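(* Let $\mathcal{M}$ be a non-standard model of Peano arithmetic and let $L\in M$. Let $\mathcal{M}^+=\langle M,0,1,+,\leq\rangle$ be the additive part of $\mathcal{M}$ and let $\cdot$ be the operation of multiplication in $\mathcal{M}$. Then there are elements $a<b$ in $M$ such that the restriction $\cdot\restriction [0,L]^2$ is $\emptyset$-definable by a $b$-bounded formula in the structure $\langle\mathcal{M}^+,a,b\rangle$, where $a,b$ stand for the unary functions $x\mapsto a\cdot x$ and $x\mapsto b\cdot x$ on $M$.
   Context: Here $M$ is the universe of $\mathcal{M}$ and $[0,L]=\{x\in M : 0\leq x\leq L\}$. The structure $\langle\mathcal{M}^+,a,b\rangle$ is a structure for the first-order language $\langle 0,1,+,\leq,a,b\rangle$, where $a,b$ are two unary function symbols interpreted as multiplication (in $\mathcal{M}$) by the elements $a$ and $b$, respectively. ''$\emptyset$-definable'' means definable without parameters; a partial function is definable if its graph (here $\{(x,y,x\cdot y): x,y\in[0,L]\}$) is. A formula of this language is called $b$-bounded if all quantifiers in it are of the form $\exists x<b1$ or $\forall x<b1$, where $b1$ is the term obtained by applying the function symbol $b$ to the constant $1$ (so its value is the element $b$). *)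

(* Defs.v *)
Set Implicit Arguments.
Unset Strict Implicit.

(* Languages whose function symbols have arity at most 2 and whose relation
   symbols are binary; this covers both languages used below. *)
Record language := Language {
  const_sym : Type;
  unary_sym : Type;
  binary_sym : Type;
  rel_sym : Type
}.

Inductive term (lang : language) : Type :=
| Var (i : nat)
| Cst (c : const_sym lang)
| Un (f : unary_sym lang) (t : term lang)
| Bin (f : binary_sym lang) (t u : term lang).

Arguments Var {lang} i.
Arguments Cst {lang} c.
Arguments Un {lang} f t.
Arguments Bin {lang} f t u.

(* De Bruijn indices: in [All p] and [Ex p] the index 0 of [p] is the bound
   variable, and the index [S i] of [p] is the variable [i] outside. *)
Inductive formula (lang : language) : Type :=
| Equ (t u : term lang)
| Rel (r : rel_sym lang) (t u : term lang)
| Neg (p : formula lang)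
| And (p q : formula lang)
| Or (p q : formula lang)
| Imp (p q : formula lang)
| All (p : formula lang)
| Ex (p : formula lang).

Arguments Equ {lang} t u.
Arguments Rel {lang} r t u.
Arguments Neg {lang} p.
Arguments And {lang} p q.
Arguments Or {lang} p q.
Arguments Imp {lang} p q.
Arguments All {lang} p.
Arguments Ex {lang} p.

(* All (free) variables are among those of index 0, ..., n-1. *)
Fixpoint term_below (lang : language) (n : nat) (t : term lang) : Prop :=
  match t with
  | Var i => i < n
  | Cst _ => True
  | Un _ t => term_below n t
  | Bin _ t u => term_below n t /\ term_below n u
  end.

Fixpoint free_below (lang : language) (n : nat) (p : formula lang) : Prop :=
  match p with
  | Equ t u | Rel _ t u => term_below n t /\ term_below n u
  | Neg p => free_below n p
  | And p q | Or p q | Imp p q => free_below n p /\ free_below n q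
  | All p | Ex p => free_below (S n) p
  end.

Record structure (lang : language) := Structure {
  carrier :> Type;
  cst_interp : const_sym lang -> carrier;
  un_interp : unary_sym lang -> carrier -> carrier;
  bin_interp : binary_sym lang -> carrier -> carrier -> carrier;
  rel_interp : rel_sym lang -> carrier -> carrier -> Prop
}.

Definition scons (T : Type) (x : T) (e : nat -> T) (i : nat) : T :=
  match i with
  | 0 => x
  | S j => e j
  end.

Fixpoint eval (lang : language) (M : structure lang) (e : nat -> M) (t : term lang) : M :=
  match t with
  | Var i => e i
  | Cst c => cst_interp M c
  | Un f t => un_interp f (eval e t)
  | Bin f t u => bin_interp f (eval e t) (eval e u)
  end.

Fixpoint sat (lang : language) (M : structure lang) (e : nat -> M) (p : formula lang) : Prop :=
  match p with
  | Equ t u => eval e t = eval e u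
  | Rel r t u => rel_interp r (eval e t) (eval e u)
  | Neg p => ~ sat e p
  | And p q => sat e p /\ sat e q
  | Or p q => sat e p \/ sat e q
  | Imp p q => sat e p -> sat e q
  | All p => forall x : M, sat (scons x e) p
  | Ex p => exists x : M, sat (scons x e) p
  end.

(* [p] defines the ternary relation [R] in [M] without parameters: its only free
   variables are those of index 0, 1, 2 (so the tail [e] is irrelevant). *)
Definition defines3 (lang : language) (M : structure lang) (p : formula lang)
    (R : M -> M -> M -> Prop) : Prop :=
  free_below 3 p /\
  forall (e : nat -> M) (x y z : M),
    sat (scons x (scons y (scons z e))) p <-> R x y z.

Definition isomorphic (lang : language) (M N : structure lang) : Prop :=
  exists (f : M -> N) (g : N -> M),
    (forall x, g (f x) = x) /\ (forall y, f (g y) = y) /\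
    (forall c, f (cst_interp M c) = cst_interp N c) /\
    (forall h x, f (un_interp h x) = un_interp h (f x)) /\
    (forall h x y, f (bin_interp h x y) = bin_interp h (f x) (f y)) /\
    (forall r x y, rel_interp r x y <-> rel_interp r (f x) (f y)).

Inductive zero_one : Type := Zero | One.
Inductive plus_times : Type := Plus | Times.
Inductive leq_symbol : Type := Leq.

Definition arith : language :=
  Language zero_one Empty_set plus_times leq_symbol.

Definition zero (M : structure arith) : M := cst_interp M Zero.
Definition one (M : structure arith) : M := cst_interp M One.
Definition add (M : structure arith) (x y : M) : M := @bin_interp arith M Plus x y.
Definition mul (M : structure arith) (x y : M) : M := @bin_interp arith M Times x y.
Definition le (M : structure arith) (x y : M) : Prop := @rel_interp arith M Leq x y.
Definition lt (M : structure arith) (x y : M) : Prop := le x y /\ x <> y.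

(* The induction scheme ranges over all formulas of [arith], with parameters
   given by the assignment [e]. *)
Record PA_model (M : structure arith) : Prop := {
  PA_succ_neq0 : forall x : M, add x (one M) <> zero M;
  PA_succ_inj : forall x y : M, add x (one M) = add y (one M) -> x = y;
  PA_add0 : forall x : M, add x (zero M) = x;
  PA_addS : forall x y : M, add x (add y (one M)) = add (add x y) (one M);
  PA_mul0 : forall x : M, mul x (zero M) = zero M;
  PA_mulS : forall x y : M, mul x (add y (one M)) = add (mul x y) x;
  PA_le : forall x y : M, le x y <-> exists z : M, add x z = y;
  PA_induction : forall (p : formula arith) (e : nat -> M),
    sat (scons (zero M) e) p ->
    (forall x : M, sat (scons x e) p -> sat (scons (add x (one M)) e) p) ->
    forall x : M, sat (scons x e) p
}.

Definition standard_model : structure arith :=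
  @Structure arith nat
    (fun c => match c with Zero => 0 | One => 1 end)
    (fun f _ => match f with end)
    (fun f => match f with Plus => Nat.add | Times => Nat.mul end)
    (fun _ => Peano.le).

Definition nonstandard (M : structure arith) : Prop :=
  ~ isomorphic standard_model M.

Inductive scalar_symbol : Type := ScalA | ScalB.
Inductive plus_symbol : Type := AddPlus.

Definition additive_ab : language :=
  Language zero_one scalar_symbol plus_symbol leq_symbol.

Definition additive_expansion (M : structure arith) (a b : M) : structure additive_ab :=
  @Structure additive_ab M
    (fun c => cst_interp M c)
    (fun f x => match f with ScalA => mul a x | ScalB => mul b x end)
    (fun _ x y => add x y)
    (fun _ x y => le x y).

Definition b1 : term additive_ab := @Un additive_ab ScalB (@Cst additive_ab One).

(* Strict inequality abbreviates "t <= u and t <> u". *)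
Definition Lt (t u : term additive_ab) : formula additive_ab :=
  And (@Rel additive_ab Leq t u) (Neg (Equ t u)).

Inductive b_bounded : formula additive_ab -> Prop :=
| b_bounded_Equ t u : b_bounded (Equ t u)
| b_bounded_Rel r t u : b_bounded (Rel r t u)
| b_bounded_Neg p : b_bounded p -> b_bounded (Neg p)
| b_bounded_And p q : b_bounded p -> b_bounded q -> b_bounded (And p q)
| b_bounded_Or p q : b_bounded p -> b_bounded q -> b_bounded (Or p q)
| b_bounded_Imp p q : b_bounded p -> b_bounded q -> b_bounded (Imp p q)
| b_bounded_All p : b_bounded p -> b_bounded (All (Imp (Lt (Var 0) b1) p))
| b_bounded_Ex p : b_bounded p -> b_bounded (Ex (And (Lt (Var 0) b1) p)).

Definition in_segment (M : structure arith) (L x : M) : Prop :=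
  le (zero M) x /\ le x L.

Definition mul_graph_upto (M : structure arith) (L x y z : M) : Prop :=
  in_segment L x /\ in_segment L y /\ z = mul x y.

(* Main.v *)
Require Import Defs.
From Stdlib Require Import Ring Setoid PeanoNat.

(* Call [x] with [0 < x < q] a record of [p/q] if the residue of [p x] modulo [q] is
   smaller than that of every smaller positive multiplier. If [P q = p Q + 1] and
   [q < Q], then [P/Q] has the same records as [p/q] and the additional record [q].
   A second fraction [G/q] can be refined along such a sequence so that the first
   base-[B] digit of the fractional part of [G x/q] at the successive records [x] runs
   through any prescribed sequence, here the squares up to [(2L + 1)^2]. Hence the set
   of these squares is definable from the multiplications by [p], [q], [B G] and [B q];
   it determines squaring as [x^2] and [(x + 1)^2] are consecutive squares, and so it
   determines the product by polarization. Finally, these four multipliers and [L] are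
   the digits of [b] in a sufficiently large base [a], so that multiplication by [a]
   and [b] suffices. *)

Set Implicit Arguments.
Unset Strict Implicit.

(** * Definable sets of assignments *)

Section Definability.

Variables (lang : language) (N : structure lang).

Definition definable_term (n : nat) (t : (nat -> N) -> N) : Prop :=
  exists u : term lang, term_below n u /\ forall e, eval e u = t e.

Lemma definable_var n i : Nat.ltb i n = true -> definable_term n (fun e => e i).
Proof. intros H. exists (Var i). split; [now apply Nat.ltb_lt | reflexivity]. Qed.

Lemma definable_cst n c : definable_term n (fun _ => cst_interp N c).
Proof. now exists (Cst c). Qed.

Lemma definable_un n f t :
  definable_term n t -> definable_term n (fun e => un_interp f (t e)).
Proof.
  intros [u [Hu E]]. exists (Un f u). split; [exact Hu |].
  intros e; simpl. now rewrite E.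
Qed.

Lemma definable_bin n f t t' : definable_term n t -> definable_term n t' ->
  definable_term n (fun e => bin_interp f (t e) (t' e)).
Proof.
  intros [u [Hu E]] [u' [Hu' E']]. exists (Bin f u u'). split; [now split |].
  intros e; simpl. now rewrite E, E'.
Qed.

(** The class [K] is a parameter so that one set of connective lemmas serves both arbitrary
    formulas, as needed for induction, and [b_bounded] ones. The two classes differ in their
    quantifiers, which are treated separately for each. *)
Definition definable (K : formula lang -> Prop) (n : nat) (P : (nat -> N) -> Prop) : Prop :=
  exists p : formula lang, K p /\ free_below n p /\ forall e, sat e p <-> P e.

Record connective_closed (K : formula lang -> Prop) : Prop := {
  closed_Equ : forall t u, K (Equ t u);
  closed_Rel : forall r t u, K (Rel r t u);
  closed_Neg : forall p, K p -> K (Neg p);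
  closed_And : forall p q, K p -> K q -> K (And p q);
  closed_Or : forall p q, K p -> K q -> K (Or p q);
  closed_Imp : forall p q, K p -> K q -> K (Imp p q)
}.

Variables (K : formula lang -> Prop) (HK : connective_closed K).

Lemma definable_eq n t t' : definable_term n t -> definable_term n t' ->
  definable K n (fun e => t e = t' e).
Proof.
  intros [u [Hu E]] [u' [Hu' E']]. exists (Equ u u').
  split; [now apply closed_Equ | split; [now split |]].
  intros e; simpl. now rewrite E, E'.
Qed.

Lemma definable_rel n r t t' : definable_term n t -> definable_term n t' ->
  definable K n (fun e => rel_interp r (t e) (t' e)).
Proof.
  intros [u [Hu E]] [u' [Hu' E']]. exists (Rel r u u').
  split; [now apply closed_Rel | split; [now split |]].
  intros e; simpl. now rewrite E, E'.
Qed.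

Lemma definable_not n P : definable K n P -> definable K n (fun e => ~ P e).
Proof.
  intros [p [Kp [Hp E]]]. exists (Neg p).
  split; [now apply closed_Neg | split; [exact Hp |]].
  intros e; simpl. now rewrite E.
Qed.

Lemma definable_and n P Q : definable K n P -> definable K n Q ->
  definable K n (fun e => P e /\ Q e).
Proof.
  intros [p [Kp [Hp E]]] [q [Kq [Hq F]]]. exists (And p q).
  split; [now apply closed_And | split; [now split |]].
  intros e; simpl. now rewrite E, F.
Qed.

Lemma definable_or n P Q : definable K n P -> definable K n Q ->
  definable K n (fun e => P e \/ Q e).
Proof.
  intros [p [Kp [Hp E]]] [q [Kq [Hq F]]]. exists (Or p q).
  split; [now apply closed_Or | split; [now split |]].
  intros e; simpl. now rewrite E, F.
Qed.

Lemma definable_imp n P Q : definable K n P -> definable K n Q ->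
  definable K n (fun e => P e -> Q e).
Proof.
  intros [p [Kp [Hp E]]] [q [Kq [Hq F]]]. exists (Imp p q).
  split; [now apply closed_Imp | split; [now split |]].
  intros e; simpl. now rewrite E, F.
Qed.

End Definability.

Section Arithmetic.

Variables (M : structure arith) (HPA : PA_model M).

Local Notation "0" := (zero M).
Local Notation "1" := (one M).
Local Infix "+" := (@add M).
Local Infix "*" := (@mul M).
Local Infix "<=" := (@le M).
Local Infix "<" := (@lt M).

(** * Induction for definable predicates *)

Local Notation arith_definable := (@definable arith M (fun _ => True)).

Lemma any_connective_closed : connective_closed (fun _ : formula arith => True).
Proof. now split. Qed.

Lemma arith_definable_all n (R : M -> (nat -> M) -> Prop) :
  arith_definable (S n) (fun e => R (e 0%nat) (fun i => e (S i))) ->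
  arith_definable n (fun e => forall x, R x e).
Proof.
  intros [p [_ [Hp E]]]. exists (All p). split; [exact I | split; [exact Hp |]].
  intros e; simpl. split; intros H x; apply (E (scons x e)), H.
Qed.

Lemma arith_definable_ex n (R : M -> (nat -> M) -> Prop) :
  arith_definable (S n) (fun e => R (e 0%nat) (fun i => e (S i))) ->
  arith_definable n (fun e => exists x, R x e).
Proof.
  intros [p [_ [Hp E]]]. exists (Ex p). split; [exact I | split; [exact Hp |]].
  intros e; simpl.
  split; intros [x H]; exists x; apply (E (scons x e)), H.
Qed.

(** The formula is read off the shape of the predicate. Implications and universal quantifiers are
    both products, so the last case tries them in turn. *)
Ltac arith_definability :=
  cbv beta;
  lazymatch goal with
  | |- arith_definable _ (fun e => _ /\ _) =>
      apply (definable_and any_connective_closed); arith_definability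
  | |- arith_definable _ (fun e => _ \/ _) =>
      apply (definable_or any_connective_closed); arith_definability
  | |- arith_definable _ (fun e => ~ _) =>
      apply (definable_not any_connective_closed); arith_definability
  | |- arith_definable _ (fun e => exists x, _) =>
      apply arith_definable_ex; arith_definability
  | |- arith_definable _ (fun e => _ = _) =>
      apply (definable_eq any_connective_closed); arith_definability
  | |- arith_definable _ (fun e => lt _ _) => unfold lt; arith_definability
  | |- arith_definable _ (fun e => le _ _) =>
      apply (definable_rel any_connective_closed Leq); arith_definability
  | |- definable_term _ (fun e => add _ _) =>
      apply (@definable_bin arith M _ Plus); arith_definability
  | |- definable_term _ (fun e => mul _ _) =>
      apply (@definable_bin arith M _ Times); arith_definability
  | |- definable_term _ (fun e => zero _) => apply (@definable_cst arith M _ Zero)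
  | |- definable_term _ (fun e => one _) => apply (@definable_cst arith M _ One)
  | |- definable_term _ _ => apply definable_var; reflexivity
  | |- _ =>
      first [ apply (definable_imp any_connective_closed)
            | apply arith_definable_all ]; arith_definability
  end.

(** The scheme covers formulas only, so definability has to be exhibited. With variable 0 as the
    only free one, no parameters are allowed: statements are generalized over all other variables
    before [induct]. *)
Lemma induction (P : M -> Prop) :
  arith_definable 1 (fun e => P (e 0%nat)) ->
  P 0 -> (forall x, P x -> P (x + 1)) -> forall x, P x.
Proof.
  intros [p [_ [_ E]]] H0 HS x.
  apply (E (scons x (fun _ => 0))).
  apply PA_induction; [exact HPA | now apply (E (scons _ _)) |].
  intros y Hy. apply (E (scons _ _)), HS, (E (scons y (fun _ => 0))), Hy.
Qed.

Ltac induct x :=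
  revert x;
  lazymatch goal with
  | |- forall x, @?P x => apply (@induction P); cbv beta; [arith_definability | |]
  end.

(** * Ordered semiring structure of models of arithmetic *)

Lemma add_0_r x : x + 0 = x.
Proof. apply (PA_add0 HPA). Qed.

Lemma add_assoc x y z : x + (y + z) = (x + y) + z.
Proof.
  revert x y. induct z.
  - intros x y. now rewrite !add_0_r.
  - intros z IH x y. now rewrite !(PA_addS HPA), IH.
Qed.

Lemma add_0_l x : 0 + x = x.
Proof.
  induct x.
  - apply add_0_r.
  - intros x IH. now rewrite (PA_addS HPA), IH.
Qed.

Lemma add_1_l x : 1 + x = x + 1.
Proof.
  induct x.
  - now rewrite add_0_r, add_0_l.
  - intros x IH. now rewrite (PA_addS HPA), IH.
Qed.

Lemma add_comm x y : x + y = y + x.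
Proof.
  revert x. induct y.
  - intros x. now rewrite add_0_r, add_0_l.
  - intros y IH x.
    now rewrite (PA_addS HPA), IH, <- (PA_addS HPA), <- add_1_l, add_assoc.
Qed.

Lemma mul_1_r x : x * 1 = x.
Proof.
  rewrite <- (add_0_l 1), (PA_mulS HPA), (PA_mul0 HPA). apply add_0_l.
Qed.

Lemma mul_add_r x y z : x * (y + z) = x * y + x * z.
Proof.
  revert x y. induct z.
  - intros x y. now rewrite (PA_mul0 HPA), !add_0_r.
  - intros z IH x y.
    now rewrite (PA_addS HPA), !(PA_mulS HPA), IH, add_assoc.
Qed.

Lemma mul_0_l x : 0 * x = 0.
Proof.
  induct x.
  - apply (PA_mul0 HPA).
  - intros x IH. now rewrite (PA_mulS HPA), IH, add_0_r.
Qed.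

Lemma mul_add_l x y z : (x + y) * z = x * z + y * z.
Proof.
  revert x y. induct z.
  - intros x y. now rewrite !(PA_mul0 HPA), add_0_r.
  - intros z IH x y. rewrite !(PA_mulS HPA), IH, !add_assoc. f_equal.
    rewrite <- !add_assoc. f_equal. apply add_comm.
Qed.

Lemma mul_1_l x : 1 * x = x.
Proof.
  induct x.
  - apply (PA_mul0 HPA).
  - intros x IH. now rewrite (PA_mulS HPA), IH.
Qed.

Lemma mul_comm x y : x * y = y * x.
Proof.
  revert x. induct y.
  - intros x. now rewrite (PA_mul0 HPA), mul_0_l.
  - intros y IH x. now rewrite (PA_mulS HPA), mul_add_l, mul_1_l, IH.
Qed.

Lemma mul_assoc x y z : x * (y * z) = (x * y) * z.
Proof.
  revert x y. induct z.
  - intros x y. now rewrite !(PA_mul0 HPA).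
  - intros z IH x y. now rewrite !(PA_mulS HPA), mul_add_r, IH.
Qed.

Lemma PA_semi_ring : semi_ring_theory 0 1 (@add M) (@mul M) eq.
Proof.
  split.
  - exact add_0_l.
  - exact add_comm.
  - exact add_assoc.
  - exact mul_1_l.
  - exact mul_0_l.
  - exact mul_comm.
  - exact mul_assoc.
  - exact mul_add_l.
Qed.

Add Ring PA_ring : PA_semi_ring.

Lemma add_cancel_r x y z : x + z = y + z -> x = y.
Proof.
  revert x y. induct z.
  - intros x y. now rewrite !add_0_r.
  - intros z IH x y H. apply IH, (PA_succ_inj HPA). now rewrite <- !(PA_addS HPA).
Qed.

Lemma add_cancel_l x y z : z + x = z + y -> x = y.
Proof. rewrite !(add_comm z). apply add_cancel_r. Qed.

Lemma zero_or_succ x : x = 0 \/ exists y, x = y + 1.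
Proof.
  induct x.
  - now left.
  - intros x _. right. now exists x.
Qed.

Lemma add_eq_0 x y : x + y = 0 -> x = 0.
Proof.
  intros H. destruct (zero_or_succ x) as [-> | [z ->]]; [reflexivity |].
  destruct (PA_succ_neq0 HPA (x := z + y)). rewrite <- H. ring.
Qed.

Lemma lt_iff x y : x < y <-> exists z, x + z + 1 = y.
Proof.
  unfold lt. rewrite (PA_le HPA). split.
  - intros [[z <-] Hn]. destruct (zero_or_succ z) as [-> | [w ->]].
    + destruct Hn. ring.
    + exists w. ring.
  - intros [z <-]. split.
    + exists (z + 1). ring.
    + intros H. apply (PA_succ_neq0 HPA (x := z)), (add_cancel_l (z := x)).
      rewrite add_0_r, add_assoc. now symmetry.
Qed.

Lemma le_or_lt x y : x <= y \/ y < x.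
Proof.
  revert y. induct x.
  - intros y. left. apply (PA_le HPA). exists y. ring.
  - intros x IH y. destruct (IH y) as [H | H].
    + apply (PA_le HPA) in H. destruct H as [z <-].
      destruct (zero_or_succ z) as [-> | [w ->]].
      * right. apply lt_iff. exists 0. ring.
      * left. apply (PA_le HPA). exists w. ring.
    + right. apply lt_iff in H. destruct H as [z <-].
      apply lt_iff. exists (z + 1). ring.
Qed.

Lemma le_add_r x y : x <= x + y.
Proof. apply (PA_le HPA). now exists y. Qed.

Lemma le_refl x : x <= x.
Proof. apply (PA_le HPA). exists 0. ring. Qed.

Lemma le_0_l x : 0 <= x.
Proof. apply (PA_le HPA). exists x. ring. Qed.

Lemma lt_irrefl x : ~ x < x.
Proof. now intros [_ H]. Qed.

Lemma lt_le x y : x < y -> x <= y.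
Proof. now intros [H _]. Qed.

Lemma le_trans x y z : x <= y -> y <= z -> x <= z.
Proof.
  rewrite !(PA_le HPA). intros [u <-] [v <-]. exists (u + v). ring.
Qed.

Lemma le_lt_trans x y z : x <= y -> y < z -> x < z.
Proof.
  rewrite (PA_le HPA), !lt_iff. intros [u <-] [v <-]. exists (u + v). ring.
Qed.

Lemma lt_le_trans x y z : x < y -> y <= z -> x < z.
Proof.
  rewrite (PA_le HPA), !lt_iff. intros [u <-] [v <-]. exists (u + v). ring.
Qed.

Lemma le_not_lt x y : x <= y -> ~ y < x.
Proof. intros H H'. apply (@lt_irrefl x). now apply le_lt_trans with y. Qed.

Lemma not_lt_le x y : ~ x < y -> y <= x.
Proof. now destruct (le_or_lt y x). Qed.

Lemma not_le_lt x y : ~ x <= y -> y < x.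
Proof. now destruct (le_or_lt x y). Qed.

Lemma le_antisym x y : x <= y -> y <= x -> x = y.
Proof.
  rewrite !(PA_le HPA). intros [u <-] [v Hv].
  replace u with 0; [ring |]. symmetry. apply (@add_eq_0 u v).
  apply (add_cancel_l (z := x)). rewrite add_assoc, Hv. ring.
Qed.

Lemma lt_le_succ x y : x < y -> x + 1 <= y.
Proof. rewrite lt_iff, (PA_le HPA). intros [z <-]; exists z; ring. Qed.

Lemma le_lt_succ x y : x <= y -> x < y + 1.
Proof. rewrite lt_iff, (PA_le HPA). intros [z <-]; now exists z. Qed.

Lemma lt_succ_le x y : x < y + 1 -> x <= y.
Proof.
  rewrite lt_iff, (PA_le HPA). intros [z Hz]. exists z.
  now apply (add_cancel_r (z := 1)).
Qed.

Lemma lt_1_eq_0 x : x < 1 -> x = 0.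
Proof.
  intros H. apply le_antisym; [| apply le_0_l].
  apply lt_succ_le. now rewrite add_0_l.
Qed.

Lemma lt_0_1 : 0 < 1.
Proof. apply lt_iff. exists 0. ring. Qed.

Lemma add_le x y z w : x <= y -> z <= w -> x + z <= y + w.
Proof.
  rewrite !(PA_le HPA). intros [u <-] [v <-]. exists (u + v). ring.
Qed.

Lemma add_lt_le x y z w : x < y -> z <= w -> x + z < y + w.
Proof.
  rewrite (PA_le HPA), !lt_iff. intros [u <-] [v <-]. exists (u + v). ring.
Qed.

Lemma mul_le x y z w : x <= y -> z <= w -> x * z <= y * w.
Proof.
  rewrite !(PA_le HPA). intros [u <-] [v <-].
  exists (x * v + u * z + u * v). ring.
Qed.

Lemma mul_lt_l x y z : 0 < x -> y < z -> x * y < x * z.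
Proof.
  rewrite !lt_iff. intros [u <-] [v <-].
  exists (u * v + u + v). ring.
Qed.

Lemma mul_pos x y : 0 < x -> 0 < y -> 0 < x * y.
Proof.
  intros Hx Hy. replace 0 with (x * 0) by ring. now apply mul_lt_l.
Qed.

Lemma mul_lt_cancel_l x y z : x * y < x * z -> y < z.
Proof.
  intros H. apply not_le_lt. intros H'. apply (le_not_lt (mul_le (le_refl x) H')).
  exact H.
Qed.

Lemma mul_le_cancel_l x y z : 0 < x -> x * y <= x * z -> y <= z.
Proof.
  intros Hx H. apply not_lt_le. intros H'. apply (le_not_lt H).
  now apply mul_lt_l.
Qed.

Lemma mul_cancel_l x y z : 0 < x -> x * y = x * z -> y = z.
Proof.
  intros Hx H.
  apply le_antisym; apply (@mul_le_cancel_l x); trivial; rewrite H; apply le_refl.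
Qed.

Lemma euclid x d : 0 < d -> exists q r, x = d * q + r /\ r < d.
Proof.
  intros Hd. revert x.
  cut (forall x d, 0 < d -> exists q r, x = d * q + r /\ r < d); [now eauto |].
  clear d Hd. intros x. induct x.
  - intros d Hd. exists 0, 0. split; [ring | exact Hd].
  - intros x IH d Hd. destruct (IH d Hd) as [q [r [-> Hr]]].
    apply lt_iff in Hr. destruct Hr as [z Hr].
    destruct (zero_or_succ z) as [-> | [w ->]].
    + exists (q + 1), 0. split; [rewrite <- Hr; ring | exact Hd].
    + exists q, (r + 1). split; [ring |].
      apply lt_iff. exists w. rewrite <- Hr. ring.
Qed.


Lemma euclid_unique d q r q' r' :
  r < d -> r' < d -> d * q + r = d * q' + r' -> q = q' /\ r = r'.
Proof.
  (* By symmetry one inequality suffices: if [q' < q], then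
     [d * q' + r' < d * (q' + 1) <= d * q]. *)
  assert (Hle : forall q r q' r', r' < d -> d * q + r = d * q' + r' -> q <= q').
  { clear q r q' r'. intros q r q' r' Hr E. apply not_lt_le. intros Hq.
    apply lt_le_succ in Hq.
    apply (@lt_irrefl (d * q + r)). rewrite E at 1.
    apply lt_le_trans with (d * (q' + 1)).
    - replace (d * q' + r') with (r' + d * q') by ring.
      replace (d * (q' + 1)) with (d + d * q') by ring.
      apply add_lt_le; [exact Hr | apply le_refl].
    - apply le_trans with (d * q); [now apply mul_le; [apply le_refl |] | apply le_add_r]. }
  intros Hr Hr' E.
  assert (Eq : q = q') by (apply le_antisym; eauto).
  split; [exact Eq |]. subst q'. now apply add_cancel_l in E.
Qed.


(** * Records of a fraction *)

(** A relation instead of a function, so that [record] stays a formula of arithmetic and may occur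
    in an induction. *)
Definition residue (p q x r : M) : Prop := r < q /\ exists v, p * x = q * v + r.

Definition record (p q x : M) : Prop :=
  0 < x /\ x < q /\ exists r, residue p q x r /\
    forall y, 0 < y -> y < x -> forall t, residue p q y t -> r < t.

Lemma residue_exists p q x : 0 < q -> exists r, residue p q x r.
Proof.
  intros Hq. destruct (euclid (p * x) Hq) as [v [r [E Hr]]].
  exists r. split; [exact Hr | now exists v].
Qed.

Lemma residue_unique p q x r r' : residue p q x r -> residue p q x r' -> r = r'.
Proof.
  intros [Hr [v E]] [Hr' [v' E']]. rewrite E in E'.
  now apply (euclid_unique Hr Hr') in E'.
Qed.

Section NextFraction.

Variables (p q P Q : M) (HPQ : P * q = p * Q + 1) (Hq : 0 < q) (HqQ : q < Q).

(* [P/Q = p/q + 1/(qQ)], so the fractional parts satisfy [R/Q = r/q + x/(qQ)]. *)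
Lemma residue_lift x r : x < q -> residue p q x r ->
  exists R, residue P Q x R /\ q * R = Q * r + x.
Proof.
  intros Hx [Hr [v E]].
  assert (Hv : q * (P * x) = q * (Q * v) + (Q * r + x)).
  { transitivity ((P * q) * x); [ring |]. rewrite HPQ.
    transitivity (Q * (p * x) + x); [ring |]. rewrite E. ring. }
  assert (HR : Q * v <= P * x).
  { apply (mul_le_cancel_l Hq). rewrite Hv. apply le_add_r. }
  apply (PA_le HPA) in HR. destruct HR as [R HR].
  assert (ER : q * R = Q * r + x).
  { apply (add_cancel_l (z := q * (Q * v))). rewrite <- Hv, <- HR. ring. }
  exists R. split; [| exact ER]. split; [| now exists v].
  apply (@mul_lt_cancel_l q). rewrite ER.
  apply lt_le_trans with (Q + Q * r).
  - rewrite (add_comm (Q * r)). apply add_lt_le; [| apply le_refl].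
    apply lt_le_trans with q; [exact Hx | now apply lt_le].
  - replace (Q + Q * r) with (Q * (r + 1)) by ring. rewrite (mul_comm q).
    apply mul_le; [apply le_refl | now apply lt_le_succ].
Qed.

Lemma residue_denominator : residue P Q q 1.
Proof.
  split; [| exists p; rewrite HPQ; ring].
  apply le_lt_trans with q; [| exact HqQ].
  apply lt_le_succ in Hq. now rewrite add_0_l in Hq.
Qed.

(** In [Q * r + x] the summand [x] acts as a low digit, being less than [Q]; so a strict inequality
    between the old residues decides the one between the new residues. *)
Lemma residue_lift_lt x y r t R T : x < q ->
  q * R = Q * r + x -> q * T = Q * t + y -> r < t -> R < T.
Proof.
  intros Hx ER ET Hrt. apply (@mul_lt_cancel_l q). rewrite ER, ET.
  apply lt_le_trans with (Q + Q * r).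
  - rewrite (add_comm (Q * r)). apply add_lt_le; [| apply le_refl].
    apply lt_le_trans with q; [exact Hx | now apply lt_le].
  - replace (Q + Q * r) with (Q * (r + 1)) by ring.
    apply le_trans with (Q * t); [| apply le_add_r].
    apply mul_le; [apply le_refl | now apply lt_le_succ].
Qed.

(** Below [q] lifting preserves comparisons of residues, so the records stay the same. At [q] the
    residue is 1, less than all earlier ones. Past [q] a record would need residue 0, which
    coprimality of [P] and [Q] forbids for [0 < x < Q]. *)
Lemma record_next x : record P Q x <-> x = q \/ record p q x.
Proof.
  split.
  - intros [Hx0 [HxQ [R [HR Hmin]]]].
    destruct (le_or_lt x q) as [Hxq | Hqx].
    + destruct (le_or_lt q x) as [Hqx | Hlt]; [left; now apply le_antisym |].
      right. split; [exact Hx0 | split; [exact Hlt |]].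
      destruct (residue_exists p x Hq) as [r Hr].
      exists r. split; [exact Hr |]. intros y Hy0 Hyx t Ht.
      destruct (residue_lift Hlt Hr) as [R' [HR' ER]].
      rewrite <- (residue_unique HR HR') in ER.
      assert (Hyq : y < q) by (apply lt_le_trans with x; [exact Hyx | exact Hxq]).
      destruct (residue_lift Hyq Ht) as [T [HT ET]].
      apply not_le_lt. intros Htr.
      apply (le_not_lt (x := q * T) (y := q * R)).
      * rewrite ER, ET. apply add_le; [| now apply lt_le].
        apply mul_le; [apply le_refl | exact Htr].
      * apply mul_lt_l; [exact Hq | now apply (Hmin y)].
    + exfalso. pose proof (Hmin q Hq Hqx 1 residue_denominator) as HR1.
      destruct HR as [HRQ [v E]].
      rewrite (lt_1_eq_0 HR1) in E.
      (* Multiplying [P * x = Q * v] by [q] and using [P * q = p * Q + 1] shows that [Q] divides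
         [x]. *)
      assert (E' : Q * (p * x) + x = Q * (v * q) + 0).
      { transitivity ((P * q) * x); [rewrite HPQ; ring |].
        transitivity ((P * x) * q); [ring |]. rewrite E. ring. }
      assert (HQ0 : 0 < Q) by (apply lt_le_trans with q; [exact Hq | now apply lt_le]).
      apply (euclid_unique HxQ HQ0) in E'.
      destruct E' as [_ ->]. now apply (@lt_irrefl 0).
  - intros [-> | [Hx0 [Hxq [r [Hr Hmin]]]]].
    + split; [exact Hq | split; [exact HqQ |]].
      exists 1. split; [exact residue_denominator |]. intros y Hy0 Hyq T HT.
      destruct (residue_exists p y Hq) as [t Ht].
      destruct (residue_lift Hyq Ht) as [T' [HT' ET]].
      rewrite <- (residue_unique HT HT') in ET.
      apply not_le_lt. intros HT1.
      assert (HqT : q * T <= q).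
      { rewrite <- (mul_1_r q) at 2. apply mul_le; [apply le_refl | exact HT1]. }
      (* A residue [T <= 1] is excluded: [t = 0] gives [q * T = y < q], hence [T = 0] and [y = 0]; a
         positive [t] gives [q * T >= Q > q]. *)
      destruct (zero_or_succ t) as [-> | [u ->]].
      * assert (T0 : T < 1).
        { apply (@mul_lt_cancel_l q). rewrite ET, mul_1_r.
          now replace (Q * 0 + y) with y by ring. }
        rewrite (lt_1_eq_0 T0) in ET.
        replace y with 0 in Hy0; [now apply (@lt_irrefl 0) |].
        transitivity (q * 0); [ring |]. rewrite ET. ring.
      * apply (@lt_irrefl q), lt_le_trans with Q; [exact HqQ |].
        apply le_trans with (q * T); [| exact HqT]. rewrite ET.
        replace (Q * (u + 1) + y) with (Q + (Q * u + y)) by ring. apply le_add_r.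
    + destruct (residue_lift Hxq Hr) as [R [HR ER]].
      split; [exact Hx0 | split].
      { now apply lt_le_trans with q; [| apply lt_le]. }
      exists R. split; [exact HR |]. intros y Hy0 Hyx T HT.
      destruct (residue_exists p y Hq) as [t Ht].
      assert (Hyq : y < q) by (apply lt_le_trans with x; [exact Hyx | now apply lt_le]).
      destruct (residue_lift Hyq Ht) as [T' [HT' ET]].
      rewrite <- (residue_unique HT HT') in ET.
      apply (residue_lift_lt Hxq ER ET). now apply (Hmin y).
Qed.

End NextFraction.

(** * Coding squares along the records *)

(* The whole interval [[G/q, (G+1)/q]], multiplied by [x], has its fractional part
   in [[s/B, (s+1)/B]]; this is inherited by subintervals [[G'/Q, (G'+1)/Q]]. *)
Definition coded (B G q x s : M) : Prop :=
  exists z, (B * z + s) * q <= B * G * x /\ B * (G + 1) * x <= (B * z + s + 1) * q.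

(** The two inequalities place [[G'/Q, (G'+1)/Q]] inside [[G/q, (G+1)/q]]; the same integer part [z]
    serves for both. *)
Lemma coded_refine B G q G' Q x s : 0 < q ->
  G * Q <= G' * q -> (G' + 1) * q <= (G + 1) * Q ->
  coded B G q x s -> coded B G' Q x s.
Proof.
  intros Hq H1 H2 [z [Hz1 Hz2]]. exists z. split; apply (mul_le_cancel_l Hq).
  - apply le_trans with (Q * (B * G * x)).
    + replace (q * ((B * z + s) * Q)) with (Q * ((B * z + s) * q)) by ring.
      apply mul_le; [apply le_refl | exact Hz1].
    + replace (Q * (B * G * x)) with ((B * x) * (G * Q)) by ring.
      replace (q * (B * G' * x)) with ((B * x) * (G' * q)) by ring.
      apply mul_le; [apply le_refl | exact H1].
  - apply le_trans with (Q * (B * (G + 1) * x)).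
    + replace (q * (B * (G' + 1) * x)) with ((B * x) * ((G' + 1) * q)) by ring.
      replace (Q * (B * (G + 1) * x)) with ((B * x) * ((G + 1) * Q)) by ring.
      apply mul_le; [apply le_refl | exact H2].
    + replace (q * ((B * z + s + 1) * Q)) with (Q * ((B * z + s + 1) * q)) by ring.
      apply mul_le; [apply le_refl | exact Hz2].
Qed.

(** Cut [[G/q, (G+1)/q]] into [B] equal pieces. Piece [s] has length [1/(Bq)], at least [2/Q], so it
    contains a whole interval [[G'/Q, (G'+1)/Q]]; multiplied by [q], the piece becomes
    [[G + s/B, G + (s+1)/B]]. *)
Lemma code_extend B G q Q s : 0 < q -> s < B -> B * q + B * q <= Q ->
  exists G', G * Q <= G' * q /\ (G' + 1) * q <= (G + 1) * Q /\ coded B G' Q q s.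
Proof.
  intros Hq Hs HQ.
  assert (HB : 0 < B) by (apply le_lt_trans with s; [apply le_0_l | exact Hs]).
  (* Here [g/Q] is the left end of the piece rounded down, so [g + 1] is the numerator wanted. *)
  destruct (euclid ((B * G + s) * Q) (mul_pos HB Hq)) as [g [r [E Hr]]].
  assert (H1 : (B * G + s) * Q <= B * (g + 1) * q).
  { rewrite E. replace (B * (g + 1) * q) with (B * q * g + B * q) by ring.
    apply add_le; [apply le_refl | now apply lt_le]. }
  assert (H2 : B * (g + 1 + 1) * q <= (B * G + s + 1) * Q).
  { replace ((B * G + s + 1) * Q) with ((B * G + s) * Q + Q) by ring. rewrite E.
    replace (B * (g + 1 + 1) * q) with (B * q * g + (B * q + B * q)) by ring.
    apply add_le; [apply le_add_r | exact HQ]. }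
  exists (g + 1). split; [| split].
  - apply (mul_le_cancel_l HB).
    apply le_trans with ((B * G + s) * Q).
    + replace ((B * G + s) * Q) with (B * (G * Q) + s * Q) by ring. apply le_add_r.
    + replace (B * ((g + 1) * q)) with (B * (g + 1) * q) by ring. exact H1.
  - apply (mul_le_cancel_l HB).
    apply le_trans with ((B * G + s + 1) * Q).
    + replace (B * ((g + 1 + 1) * q)) with (B * (g + 1 + 1) * q) by ring. exact H2.
    + replace (B * ((G + 1) * Q)) with ((B * G + B) * Q) by ring.
      apply mul_le; [| apply le_refl]. rewrite <- add_assoc.
      apply add_le; [apply le_refl | now apply lt_le_succ].
  - exists G. now split.
Qed.

(* [p1/q1] is a Farey neighbour of [p/q]; the next fraction is
   [((d + 1) p + p1) / ((d + 1) q + q1)] with neighbour [(d p + p1) / (d q + q1)]. *)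
Lemma squares_coded n : forall B, (forall k, k < n -> k * k < B) ->
  exists p q p1 q1 G, 0 < q /\ p * q1 + 1 = p1 * q /\
    (forall x, record p q x -> exists k, k < n /\ coded B G q x (k * k)) /\
    (forall k, k < n -> exists x, record p q x /\ coded B G q x (k * k)).
Proof.
  unfold record, residue, coded. induct n.
  (* The fraction [0/1] has no records; its neighbour is the formal fraction [1/0]. *)
  - intros B _. exists 0, 1, 1, 0, 0.
    split; [exact lt_0_1 | split; [ring |]]. split.
    + intros x [H0 [H1 _]]. exfalso.
      rewrite (lt_1_eq_0 H1) in H0. now apply (@lt_irrefl 0).
    + intros k Hk. exfalso. now apply (le_not_lt (le_0_l k)).
  - intros n IH B HB.
    assert (Hn : forall k, k < n -> k < n + 1).
    { intros k Hk. now apply le_lt_succ, lt_le. }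
    assert (Hnn : n < n + 1) by (apply le_lt_succ, le_refl).
    destruct (IH B (fun k Hk => HB k (Hn k Hk)))
      as [p [q [p1 [q1 [G [Hq [Hdet [Hcode Hall]]]]]]]].
    (* With [d = 2B] the new denominator is at least [2Bq], as [code_extend] requires. *)
    pose (d := B + B).
    pose (p1' := d * p + p1). pose (q1' := d * q + q1).
    assert (Hdet' : (p1' + p) * q = p * (q1' + q) + 1).
    { unfold p1', q1'.
      replace (p * (d * q + q1 + q) + 1) with (p * d * q + (p * q1 + 1) + p * q) by ring.
      rewrite Hdet. ring. }
    assert (HBpos : 0 < B).
    { apply le_lt_trans with (n * n); [apply le_0_l | now apply HB]. }
    assert (HQ : B * q + B * q <= q1' + q).
    { unfold q1', d.
      replace ((B + B) * q + q1 + q) with ((B * q + B * q) + (q1 + q)) by ring.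
      apply le_add_r. }
    assert (HqQ : q < q1' + q).
    { replace q with (0 + q) at 1 by ring.
      apply add_lt_le; [| apply le_refl].
      apply lt_le_trans with (d * q); [| apply le_add_r].
      apply mul_pos; [| exact Hq].
      apply lt_le_trans with B; [exact HBpos | apply le_add_r]. }
    destruct (code_extend G Hq (HB n Hnn) HQ) as [G' [H1 [H2 Hnew]]].
    exists (p1' + p), (q1' + q), p1', q1', G'.
    split; [now apply lt_le_trans with q; [| apply lt_le] |].
    split.
    { replace ((p1' + p) * q1' + 1) with (p1' * q1' + (p * q1' + 1)) by ring.
      replace (p * q1' + 1) with (p1' * q); [ring |].
      unfold p1', q1'.
      replace (p * (d * q + q1) + 1) with (p * d * q + (p * q1 + 1)) by ring.
      rewrite Hdet. ring. }
    split.
    + intros x Hx. apply (record_next Hdet' Hq HqQ) in Hx.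
      (* The one new record [q] carries the new square; the old records keep their codes because the
         intervals are nested. *)
      destruct Hx as [-> | Hx]; [now exists n |].
      destruct (Hcode x Hx) as [k [Hk Hc]].
      exists k. split; [now apply Hn |]. now apply (coded_refine Hq H1 H2).
    + intros k Hk. destruct (le_or_lt n k) as [Hnk | Hkn].
      * assert (k = n) as -> by (apply le_antisym; [now apply lt_succ_le | exact Hnk]).
        exists q. split; [now apply (record_next Hdet' Hq HqQ); left | exact Hnew].
      * destruct (Hall k Hkn) as [x [Hx Hc]]. exists x.
        split; [now apply (record_next Hdet' Hq HqQ); right |].
        now apply (coded_refine Hq H1 H2).
Qed.

(** Dividing [B * G * x] by [q] gives the quotient [B * z + s], whose remainder modulo [B] is [s].
    The right-hand side states this using only multiplications by [B * q], [q] and [B * G]. *)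
Lemma decode_coded B G q x s s' : 0 < q -> 0 < x -> s < B -> coded B G q x s ->
  (s' = s <->
   exists z, B * q * z + q * s' <= B * G * x /\
     B * G * x < B * q * z + q * s' + q /\ q * s' < B * q).
Proof.
  intros Hq Hx Hs [z [H1 H2]].
  assert (HB : 0 < B) by (apply le_lt_trans with s; [apply le_0_l | exact Hs]).
  (* The upper bound is strict because [x > 0]: [B * G * x] is less than [B * (G + 1) * x]. *)
  assert (H3 : B * G * x < B * q * z + q * s + q).
  { apply lt_le_trans with ((B * z + s + 1) * q).
    - apply lt_le_trans with (B * (G + 1) * x); [| exact H2].
      replace (B * (G + 1) * x) with (B * x + B * G * x) by ring.
      replace (B * G * x) with (0 + B * G * x) at 1 by ring.
      apply add_lt_le; [now apply mul_pos | apply le_refl].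
    - replace ((B * z + s + 1) * q) with (B * q * z + q * s + q) by ring. apply le_refl. }
  replace ((B * z + s) * q) with (B * q * z + q * s) in H1 by ring.
  split.
  - intros ->. exists z. split; [exact H1 | split; [exact H3 |]].
    rewrite (mul_comm B). now apply mul_lt_l.
  - intros [z' [H1' [H3' Hs']]].
    assert (Hs'B : s' < B).
    { apply (@mul_lt_cancel_l q). now rewrite (mul_comm q B). }
    apply (PA_le HPA) in H1, H1'. destruct H1 as [r Er], H1' as [r' Er'].
    rewrite <- Er in H3. rewrite <- Er' in H3'.
    assert (Hr : r < q).
    { apply not_le_lt. intros H. apply (le_not_lt (add_le (le_refl _) H) H3). }
    assert (Hr' : r' < q).
    { apply not_le_lt. intros H. apply (le_not_lt (add_le (le_refl _) H) H3'). }
    assert (E : q * (B * z' + s') + r' = q * (B * z + s) + r).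
    { transitivity (B * q * z' + q * s' + r'); [ring |].
      rewrite Er', <- Er. ring. }
    apply (euclid_unique Hr' Hr) in E. destruct E as [E _].
    now apply (euclid_unique Hs'B Hs) in E.
Qed.

(** * Multipliers as digits *)

Section Scalars.

Variables a b : M.

(** Multiplication by the [i]-th power of [a]; for a numeral [i] it unfolds to iterated use of the
    function symbol, hence to a term. *)
Fixpoint shift (i : nat) (x : M) : M :=
  match i with
  | O => x
  | S i => a * shift i x
  end.

(* When [b] is written in base [a] and no carries occur in [b * x], the digit of
   [b * x] at position [i] is the multiple by [x] of the digit of [b] at position [i]. *)
Definition scaled (i : nat) (x y : M) : Prop :=
  exists w, w < b /\ exists u, u < b /\
    b * x = shift i (a * w + y) + u /\ u < shift i 1 /\ y < a.

Lemma shift_mul i x : shift i x = shift i 1 * x.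
Proof.
  induction i as [| i IH]; simpl; [ring |].
  rewrite IH. ring.
Qed.

(** The hypotheses [g * x < a] and [l * x < shift i 1] exclude carries, so dividing [b * x] by
    [shift i 1] and then the quotient by [a] isolates [g * x]. *)
Lemma scaled_iff i g H l x : b = shift i (a * H + g) + l ->
  g * x < a -> l * x < shift i 1 -> shift i 1 <= b -> x < a ->
  forall y, scaled i x y <-> y = g * x.
Proof.
  intros Eb Hg Hl Hb Hx y.
  assert (Ebx : b * x = shift i 1 * (a * (H * x) + g * x) + l * x).
  { rewrite Eb at 1. rewrite (shift_mul i (a * H + g)). ring. }
  assert (Hi : 0 < shift i 1) by (apply le_lt_trans with (l * x); [apply le_0_l | exact Hl]).
  split.
  - intros [w [_ [u [_ [E [Hu Hy]]]]]].
    rewrite Ebx, (shift_mul i (a * w + y)) in E. symmetry in E.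
    apply (euclid_unique Hu Hl) in E. destruct E as [E _].
    now apply (euclid_unique Hy Hg) in E.
  - intros ->. exists (H * x). split.
    (* The witness must lie below [b]. For [H > 0] this is [H * x < H * a <= b]; the strict
       inequality fails for [H = 0], which is treated apart. *)
    + destruct (zero_or_succ H) as [-> | [H' ->]].
      * rewrite mul_0_l. now apply lt_le_trans with (shift i 1).
      * apply lt_le_trans with ((H' + 1) * a).
        -- apply mul_lt_l; [| exact Hx]. apply le_lt_succ, le_0_l.
        -- rewrite Eb, shift_mul.
           replace ((H' + 1) * a) with (1 * (a * (H' + 1) + 0) + 0) by ring.
           apply add_le; [| apply le_0_l].
           apply mul_le; [| apply add_le; [apply le_refl | apply le_0_l]].
           apply lt_le_succ in Hi. now rewrite add_0_l in Hi.
    + exists (l * x). split; [now apply lt_le_trans with (shift i 1) |].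
      split; [now rewrite (shift_mul i (a * (H * x) + g * x)) | now split].
Qed.

(** Here [X] bounds the arguments for which digit [i] of [b] acts as the multiplier [g]. The
    conjunct [g * x < a] is kept because, with [a < b], it puts the products within reach of the
    bounded quantifiers. *)
Definition scales (X : M) (i : nat) (g : M) : Prop :=
  forall x, x <= X -> g * x < a /\ forall y, scaled i x y <-> y = g * x.

(** * Bounded definability over the two scalars *)

Local Notation bounded_definable :=
  (@definable additive_ab (additive_expansion a b) b_bounded).

Lemma b_bounded_connective_closed : connective_closed b_bounded.
Proof. split; now constructor. Qed.

Lemma bounded_definable_all n (R : M -> (nat -> M) -> Prop) :
  bounded_definable (S n) (fun e => R (e 0%nat) (fun i => e (S i))) ->
  bounded_definable n (fun e => forall x, x < b -> R x e).
Proof.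
  intros [p [Kp [Hp E]]]. exists (All (Imp (Lt (Var 0) b1) p)).
  split; [now constructor |].
  split; [repeat split; [apply le_n_S, Nat.le_0_l.. | exact Hp] |].
  intros e; simpl. fold (one M). rewrite mul_1_r.
  split; intros H x Hx; apply (E (scons x e)), H, Hx.
Qed.

Lemma bounded_definable_ex n (R : M -> (nat -> M) -> Prop) :
  bounded_definable (S n) (fun e => R (e 0%nat) (fun i => e (S i))) ->
  bounded_definable n (fun e => exists x, x < b /\ R x e).
Proof.
  intros [p [Kp [Hp E]]]. exists (Ex (And (Lt (Var 0) b1) p)).
  split; [now constructor |].
  split; [repeat split; [apply le_n_S, Nat.le_0_l.. | exact Hp] |].
  intros e; simpl. fold (one M). rewrite mul_1_r.
  split; intros [x [Hx H]]; exists x; (split; [exact Hx |]); apply (E (scons x e)), H.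
Qed.

Lemma definable_scalar_a n : @definable_term _ (additive_expansion a b) n (fun _ => a).
Proof.
  exists (@Un additive_ab ScalA (@Cst additive_ab One)). split; [exact I |].
  intros e. apply mul_1_r.
Qed.

Ltac bounded_definability :=
  cbv beta;
  lazymatch goal with
  | |- bounded_definable _ (fun e => exists x, _ /\ _) =>
      apply bounded_definable_ex; bounded_definability
  | |- bounded_definable _ (fun e => _ /\ _) =>
      apply (@definable_and _ (additive_expansion a b) _ b_bounded_connective_closed);
      bounded_definability
  | |- bounded_definable _ (fun e => ~ _) =>
      apply (@definable_not _ (additive_expansion a b) _ b_bounded_connective_closed);
      bounded_definability
  | |- bounded_definable _ (fun e => _ = _) =>
      apply (@definable_eq _ (additive_expansion a b) _ b_bounded_connective_closed);
      bounded_definability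
  | |- bounded_definable _ (fun e => lt _ _) => unfold lt; bounded_definability
  | |- bounded_definable _ (fun e => le _ _) =>
      apply (@definable_rel _ (additive_expansion a b) _ b_bounded_connective_closed _
        Leq);
      bounded_definability
  | |- definable_term _ (fun e => add _ _) =>
      apply (@definable_bin additive_ab (additive_expansion a b) _ AddPlus);
      bounded_definability
  | |- definable_term _ (fun e => mul a _) =>
      apply (@definable_un additive_ab (additive_expansion a b) _ ScalA);
      bounded_definability
  | |- definable_term _ (fun e => mul b _) =>
      apply (@definable_un additive_ab (additive_expansion a b) _ ScalB);
      bounded_definability
  | |- definable_term _ (fun e => a) => apply definable_scalar_a
  | |- definable_term _ (fun e => zero _) =>
      apply (@definable_cst additive_ab (additive_expansion a b) _ Zero)
  | |- definable_term _ (fun e => one _) =>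
      apply (@definable_cst additive_ab (additive_expansion a b) _ One)
  | |- definable_term _ _ => apply definable_var; reflexivity
  | |- _ =>
      first [ apply bounded_definable_all
            | apply (@definable_imp _ (additive_expansion a b) _
                b_bounded_connective_closed) ];
      bounded_definability
  end.

(** In the intended [b] the digits at positions 0 to 4 are [p], [q], [B * G], [L] and [B * q]. So
    [scaled 1 1 q] names the denominator, and [v <= px] keeps [v] in the range where [scaled] is
    multiplication. *)
Definition bounded_residue (x r : M) : Prop :=
  exists q, q < b /\ scaled 1 1 q /\ r < q /\
  exists px, px < b /\ scaled 0 x px /\
  exists v, v < b /\ v <= px /\
  exists qv, qv < b /\ scaled 1 v qv /\ px = qv + r.

Definition bounded_record (x : M) : Prop :=
  0 < x /\ (exists q, q < b /\ scaled 1 1 q /\ x < q) /\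
  exists r, r < b /\ bounded_residue x r /\
  forall y, y < b -> 0 < y -> y < x ->
  forall t, t < b -> bounded_residue y t -> r < t.

(** The criterion of [decode_coded]. The inequalities [s <= gx] and [z <= gx] follow from it for
    positive [q] and [B], and keep both arguments in range. *)
Definition bounded_code (x s : M) : Prop :=
  exists gx, gx < b /\ scaled 2 x gx /\ s <= gx /\
  exists z, z < b /\ z <= gx /\
  exists wz, wz < b /\ scaled 4 z wz /\
  exists qs, qs < b /\ scaled 1 s qs /\
  exists q, q < b /\ scaled 1 1 q /\
  exists w, w < b /\ scaled 4 1 w /\
  wz + qs <= gx /\ gx < wz + qs + q /\ qs < w.

Definition bounded_square (s : M) : Prop :=
  exists x, x < b /\ bounded_record x /\ bounded_code x s.

(** The square after [k^2] is [k^2 + 2k + 1], so the gap to the next square determines the root. *)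
Definition bounded_root (x u : M) : Prop :=
  bounded_square u /\ bounded_square (u + x + x + 1) /\
  forall t, t < b -> u < t -> t < u + x + x + 1 -> ~ bounded_square t.

(** Digit 3 only serves to name [L], which has no constant in the language. The last equation is
    [(x + y)^2 = x^2 + y^2 + 2z]. *)
Definition bounded_product (x y z : M) : Prop :=
  (exists l, l < b /\ scaled 3 1 l /\ x <= l /\ y <= l) /\
  exists u, u < b /\ bounded_root x u /\
  exists v, v < b /\ bounded_root y v /\
  exists w, w < b /\ bounded_root (x + y) w /\ w = u + v + z + z.

Lemma bounded_product_definable :
  bounded_definable 3 (fun e => bounded_product (e 0%nat) (e 1%nat) (e 2)).
Proof.
  unfold bounded_product, bounded_root, bounded_square, bounded_code,
    bounded_record, bounded_residue, scaled; cbn [shift].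
  bounded_definability.
Qed.

End Scalars.

(** * Existence of the two scalars *)

Lemma digit_lt a d y z : y < a -> z < d -> y + a * z < a * d.
Proof.
  intros Hy Hz. apply lt_le_trans with (a + a * z).
  - apply add_lt_le; [exact Hy | apply le_refl].
  - replace (a + a * z) with (a * (z + 1)) by ring.
    apply mul_le; [apply le_refl | now apply lt_le_succ].
Qed.

(** The base [a] exceeds every [c * x] with [c] a digit and [x <= X], so [b * x] is formed without
    carries. A positive leading digit makes [b] at least the fourth power of [a]. *)
Lemma scalars_exist c0 c1 c2 c3 c4 X : 0 < c4 -> 1 <= X ->
  exists a b, a < b /\ scales a b X 0 c0 /\ scales a b X 1 c1 /\
    scales a b X 2 c2 /\ scales a b X 3 c3 /\ scales a b X 4 c4.
Proof.
  intros Hc HX.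
  pose (a := (c0 + c1 + c2 + c3 + c4 + 1) * X + 1).
  pose (b := c0 + a * (c1 + a * (c2 + a * (c3 + a * c4)))).
  (* The complement [d] witnesses that [c] is at most the sum; the extra 1 in this sum also admits
     [c = 1], giving [x < a]. *)
  assert (Ha : forall c d, c + d = c0 + c1 + c2 + c3 + c4 + 1 ->
    forall x, x <= X -> c * x < a).
  { intros c d Ed x Hx. apply le_lt_succ. rewrite <- Ed.
    apply mul_le; [apply le_add_r | exact Hx]. }
  assert (H0 := Ha c0 (c1 + c2 + c3 + c4 + 1) ltac:(ring)).
  assert (H1 := Ha c1 (c0 + c2 + c3 + c4 + 1) ltac:(ring)).
  assert (H2 := Ha c2 (c0 + c1 + c3 + c4 + 1) ltac:(ring)).
  assert (H3 := Ha c3 (c0 + c1 + c2 + c4 + 1) ltac:(ring)).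
  assert (H4 := Ha c4 (c0 + c1 + c2 + c3 + 1) ltac:(ring)).
  assert (Hx : forall x, x <= X -> x < a).
  { intros x Hx. rewrite <- (mul_1_l x).
    apply (Ha 1 (c0 + c1 + c2 + c3 + c4)); [ring | exact Hx]. }
  assert (H1a : 1 < a) by now apply Hx.
  assert (Hsucc : forall x, x <= a * x).
  { intros x. rewrite <- (mul_1_l x) at 1.
    apply mul_le; [now apply lt_le | apply le_refl]. }
  assert (Hb : a * (a * (a * (a * 1))) <= b).
  { unfold b. rewrite <- (add_0_l (a * (a * (a * (a * 1))))).
    repeat (apply add_le; [apply le_0_l |]; apply mul_le; [apply le_refl |];
            try rewrite <- (add_0_l (a * _))).
    apply lt_le_succ in Hc. now rewrite add_0_l in Hc. }
  assert (H01 : forall i, 0 < shift a i 1 /\ shift a i 1 <= shift a (S i) 1).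
  { intros i. split; [| apply Hsucc].
    induction i as [| i IH]; simpl; [exact lt_0_1 |].
    now apply lt_le_trans with (shift a i 1); [| apply Hsucc]. }
  assert (Hb3 := le_trans (proj2 (H01 3%nat)) Hb).
  assert (Hb2 := le_trans (proj2 (H01 2%nat)) Hb3).
  assert (Hb1 := le_trans (proj2 (H01 1%nat)) Hb2).
  assert (Hb0 := le_trans (proj2 (H01 0%nat)) Hb1).
  assert (L1 : forall x, x <= X -> c0 * x < a * 1).
  { intros x E. rewrite mul_1_r. now apply H0. }
  assert (L2 : forall x, x <= X -> (c0 + a * c1) * x < a * (a * 1)).
  { intros x E. replace ((c0 + a * c1) * x) with (c0 * x + a * (c1 * x)) by ring.
    apply digit_lt; [now apply H0 |]. rewrite mul_1_r. now apply H1. }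
  assert (L3 : forall x, x <= X -> (c0 + a * (c1 + a * c2)) * x < a * (a * (a * 1))).
  { intros x E.
    replace ((c0 + a * (c1 + a * c2)) * x)
      with (c0 * x + a * (c1 * x + a * (c2 * x))) by ring.
    apply digit_lt; [now apply H0 |]. apply digit_lt; [now apply H1 |].
    rewrite mul_1_r. now apply H2. }
  assert (L4 : forall x, x <= X ->
    (c0 + a * (c1 + a * (c2 + a * c3))) * x < a * (a * (a * (a * 1)))).
  { intros x E.
    replace ((c0 + a * (c1 + a * (c2 + a * c3))) * x)
      with (c0 * x + a * (c1 * x + a * (c2 * x + a * (c3 * x)))) by ring.
    apply digit_lt; [now apply H0 |]. apply digit_lt; [now apply H1 |].
    apply digit_lt; [now apply H2 |]. rewrite mul_1_r. now apply H3. }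
  exists a, b. split.
  { apply lt_le_trans with (a * a).
    - rewrite <- (mul_1_r a) at 1. apply mul_lt_l; [| exact H1a].
      now apply le_lt_trans with 1; [apply le_0_l |].
    - replace (a * a) with (a * (a * 1)) by ring. exact Hb2. }
  (* The digits above position [i] form [H], those below it form [l]. *)
  split; [| split; [| split; [| split]]]; intros x E; (split; [now auto |]);
    [ apply (@scaled_iff a b 0 c0 (c1 + a * (c2 + a * (c3 + a * c4))) 0 x)
    | apply (@scaled_iff a b 1 c1 (c2 + a * (c3 + a * c4)) c0 x)
    | apply (@scaled_iff a b 2 c2 (c3 + a * c4) (c0 + a * c1) x)
    | apply (@scaled_iff a b 3 c3 c4 (c0 + a * (c1 + a * c2)) x)
    | apply (@scaled_iff a b 4 c4 0 (c0 + a * (c1 + a * (c2 + a * c3))) x) ];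
    auto; try (unfold b; simpl; ring).
  (* Position 0 has no lower digits: [l] is 0 and is compared with [shift a 0 1], which is 1. *)
  rewrite mul_0_l. exact lt_0_1.
Qed.


Lemma square_lt_cancel x y : x * x < y * y -> x < y.
Proof.
  intros H. apply not_le_lt. intros H'. exact (le_not_lt (mul_le H' H') H).
Qed.

Lemma double_cancel x y : x + x = y + y -> x = y.
Proof.
  intros H. apply (@mul_cancel_l (1 + 1)).
  - apply lt_iff. exists 1. ring.
  - transitivity (x + x); [ring |]. rewrite H. ring.
Qed.

(** * The product *)

Section Correctness.

Variables (L n B p q G X a b : M).

Hypotheses (Hn : n = L + L + 1 + 1)
  (HB : forall k, k < n -> k * k < B)
  (Hq : 0 < q)
  (Hcode : forall x, record p q x -> exists k, k < n /\ coded B G q x (k * k))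
  (Hall : forall k, k < n -> exists x, record p q x /\ coded B G q x (k * k))
  (HX : X = (p + B * G + 1) * q)
  (Hab : a < b)
  (S0 : scales a b X 0 p)
  (S1 : scales a b X 1 q)
  (S2 : scales a b X 2 (B * G))
  (S3 : scales a b X 3 L)
  (S4 : scales a b X 4 (B * q)).

Let le_1_q : 1 <= q.
Proof. apply lt_le_succ in Hq. now rewrite add_0_l in Hq. Qed.

Let le_q_X : q <= X.
Proof.
  rewrite HX. replace ((p + B * G + 1) * q) with (q + (p + B * G) * q) by ring.
  apply le_add_r.
Qed.

Let le_1_X : 1 <= X.
Proof. now apply le_trans with q. Qed.

Let scale_bounded i g x : scales a b X i g -> x <= X -> g * x < b.
Proof.
  intros S Hx. apply lt_le_trans with a; [now apply S | now apply lt_le].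
Qed.

Let scaled_mul i g x y : scales a b X i g -> x <= X -> (scaled a b i x y <-> y = g * x).
Proof. intros S Hx. now apply S. Qed.

Let scaled_one i g y : scales a b X i g -> (scaled a b i 1 y <-> y = g).
Proof. intros S. rewrite (scaled_mul y S le_1_X). now rewrite mul_1_r. Qed.

Let scalar_bounded i g : scales a b X i g -> g < b.
Proof. intros S. rewrite <- (mul_1_r g). now apply (scale_bounded S). Qed.

Let le_q_mul x : x <= q * x.
Proof.
  rewrite <- (mul_1_l x) at 1. apply mul_le; [exact le_1_q | apply le_refl].
Qed.

(** In the converse direction the witness satisfies [v <= q * v <= p * x <= X], so it meets the
    quantifier bound and lies where [scaled] multiplies. *)
Lemma bounded_residue_iff x r : x < q -> (bounded_residue a b x r <-> residue p q x r).
Proof.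
  intros Hx.
  assert (HxX : x <= X) by (apply le_trans with q; [now apply lt_le | exact le_q_X]).
  assert (Hp : p * x <= X).
  { rewrite HX. apply mul_le; [| now apply lt_le]. rewrite <- add_assoc. apply le_add_r. }
  split.
  - intros [q' [_ [E [Hr [px [_ [Epx [v [_ [Hv [qv [_ [Eqv E']]]]]]]]]]]]].
    apply (scaled_one q' S1) in E. apply (scaled_mul px S0 HxX) in Epx. subst q' px.
    apply (scaled_mul qv S1 (le_trans Hv Hp)) in Eqv. subst qv.
    split; [exact Hr | now exists v].
  - intros [Hr [v E]].
    assert (Hv : v <= p * x).
    { rewrite E. apply le_trans with (q * v); [apply le_q_mul | apply le_add_r]. }
    exists q. split; [exact (scalar_bounded S1) |].
    split; [now apply (scaled_one q S1) |]. split; [exact Hr |].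
    exists (p * x). split; [exact (scale_bounded S0 HxX) |].
    split; [now apply (scaled_mul _ S0 HxX) |].
    exists v. split; [exact (le_lt_trans Hv (scale_bounded S0 HxX)) |].
    split; [exact Hv |].
    exists (q * v). split; [exact (scale_bounded S1 (le_trans Hv Hp)) |].
    split; [now apply (scaled_mul _ S1 (le_trans Hv Hp)) | exact E].
Qed.

Lemma bounded_record_iff x : bounded_record a b x <-> record p q x.
Proof.
  assert (Hqb := scalar_bounded S1).
  split.
  - intros [Hx0 [[q' [_ [E Hx]]] [r [_ [Hr Hmin]]]]].
    apply (scaled_one q' S1) in E. subst q'.
    split; [exact Hx0 | split; [exact Hx |]].
    exists r. split; [now apply bounded_residue_iff |].
    intros y Hy0 Hyx t Ht.
    assert (Hyq : y < q) by exact (lt_le_trans Hyx (lt_le Hx)).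
    apply (Hmin y (lt_le_trans Hyq (lt_le Hqb)) Hy0 Hyx).
    + apply lt_le_trans with q; [apply Ht | now apply lt_le].
    + now apply bounded_residue_iff.
  - intros [Hx0 [Hx [r [Hr Hmin]]]].
    split; [exact Hx0 | split].
    { exists q. split; [exact Hqb | split; [now apply (scaled_one q S1) | exact Hx]]. }
    exists r. split; [apply lt_le_trans with q; [apply Hr | now apply lt_le] |].
    split; [now apply bounded_residue_iff |].
    intros y _ Hy0 Hyx t _ Ht. apply (Hmin y Hy0 Hyx).
    apply bounded_residue_iff; [exact (lt_le_trans Hyx (lt_le Hx)) | exact Ht].
Qed.

Lemma bounded_code_iff x k s : record p q x -> k < n -> coded B G q x (k * k) ->
  (bounded_code a b x s <-> s = k * k).
Proof.
  intros [Hx0 [Hx _]] Hk Hc.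
  rewrite (decode_coded s Hq Hx0 (HB Hk) Hc).
  assert (HxX : x <= X) by (apply le_trans with q; [now apply lt_le | exact le_q_X]).
  assert (HgX : B * G * x <= X).
  { rewrite HX. apply mul_le; [| now apply lt_le].
    rewrite (add_comm p), <- add_assoc. apply le_add_r. }
  assert (HB1 : 1 <= B).
  { rewrite <- (add_0_l 1). apply lt_le_succ.
    apply le_lt_trans with (k * k); [apply le_0_l | exact (HB Hk)]. }
  split.
  - intros [gx [_ [Egx [Hs [z [_ [Hz [wz [_ [Ewz H]]]]]]]]]].
    destruct H as [qs [_ [Eqs [q' [_ [Eq [w [_ [Ew H]]]]]]]]].
    apply (scaled_mul gx S2 HxX) in Egx. subst gx.
    apply (scaled_mul wz S4 (le_trans Hz HgX)) in Ewz.
    apply (scaled_mul qs S1 (le_trans Hs HgX)) in Eqs.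
    apply (scaled_one q' S1) in Eq. apply (scaled_one w S4) in Ew.
    subst wz qs q' w. now exists z.
  - intros [z [H1 [H2 H3]]].
    (* Since [q] and [B] are at least 1, both [s] and [z] are at most [B * G * x], hence at most
       [X]. *)
    assert (Hs : s <= B * G * x).
    { apply le_trans with (q * s); [apply le_q_mul |].
      apply le_trans with (B * q * z + q * s); [| exact H1].
      rewrite add_comm. apply le_add_r. }
    assert (Hz : z <= B * G * x).
    { apply le_trans with (B * q * z); [| apply le_trans with (2 := H1), le_add_r].
      rewrite <- mul_assoc. apply le_trans with (q * z); [apply le_q_mul |].
      rewrite <- (mul_1_l (q * z)) at 1. apply mul_le; [exact HB1 | apply le_refl]. }
    assert (Hgb := scale_bounded S2 HxX).
    exists (B * G * x). split; [exact Hgb |].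
    split; [now apply (scaled_mul _ S2 HxX) | split; [exact Hs |]].
    exists z. split; [exact (le_lt_trans Hz Hgb) | split; [exact Hz |]].
    exists (B * q * z). split; [exact (scale_bounded S4 (le_trans Hz HgX)) |].
    split; [now apply (scaled_mul _ S4 (le_trans Hz HgX)) |].
    exists (q * s). split; [exact (scale_bounded S1 (le_trans Hs HgX)) |].
    split; [now apply (scaled_mul _ S1 (le_trans Hs HgX)) |].
    exists q. split; [exact (scalar_bounded S1) |].
    split; [now apply (scaled_one _ S1) |].
    exists (B * q). split; [exact (scalar_bounded S4) |].
    split; [now apply (scaled_one _ S4) | now split].
Qed.

Lemma bounded_square_iff s : bounded_square a b s <-> exists k, k < n /\ s = k * k.
Proof.
  split.
  - intros [x [_ [Hx Hs]]]. apply bounded_record_iff in Hx.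
    destruct (Hcode Hx) as [k [Hk Hc]]. exists k. split; [exact Hk |].
    now apply (bounded_code_iff s Hx Hk Hc).
  - intros [k [Hk ->]]. destruct (Hall Hk) as [x [Hx Hc]].
    exists x. split; [| split; [now apply bounded_record_iff |]].
    + apply lt_le_trans with q; [apply Hx | apply lt_le, (scalar_bounded S1)].
    + now apply (bounded_code_iff _ Hx Hk Hc).
Qed.

Lemma square_bounded k : k < n -> k * k < b.
Proof.
  intros Hk. apply lt_le_trans with B; [exact (HB Hk) |].
  apply le_trans with (B * q); [| apply lt_le, (scalar_bounded S4)].
  rewrite (mul_comm B). apply le_q_mul.
Qed.

(** The hypothesis [x + 1 < n] makes the square following [x * x] a coded one, too. *)
Lemma bounded_root_iff x u : x + 1 < n -> (bounded_root a b x u <-> u = x * x).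
Proof.
  intros Hx.
  assert (Hxn : x < n) by (apply le_lt_trans with (x + 1); [apply le_add_r | exact Hx]).
  unfold bounded_root. rewrite !bounded_square_iff. split.
  - intros [[k [Hk ->]] [[j [Hj E]] Hgap]].
    assert (Hkj : k < j).
    { apply square_lt_cancel. rewrite <- E. apply lt_iff. exists (x + x). ring. }
    (* Otherwise [(k + 1)^2] lies strictly between [k^2] and [j^2], against [Hgap]. *)
    assert (j = k + 1) as ->.
    { apply le_antisym; [| now apply lt_le_succ].
      apply not_lt_le. intros Hj'.
      assert (Hk' := lt_le_trans Hj' (lt_le Hj)).
      apply (Hgap ((k + 1) * (k + 1)) (square_bounded Hk')).
      - apply lt_iff. exists (k + k). ring.
      - rewrite E. apply le_lt_trans with (j * (k + 1)).
        + apply mul_le; [now apply lt_le | apply le_refl].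
        + apply mul_lt_l; [| exact Hj'].
          apply le_lt_trans with k; [apply le_0_l | exact Hkj].
      - apply bounded_square_iff. now exists (k + 1). }
    assert (x = k) as ->; [| reflexivity].
    apply double_cancel, (add_cancel_l (z := k * k + 1)).
    transitivity (k * k + x + x + 1); [ring |]. rewrite E. ring.
  - intros ->. split; [now exists x |]. split; [exists (x + 1); split; [exact Hx | ring] |].
    intros t _ H1 H2 Ht. apply bounded_square_iff in Ht. destruct Ht as [k [_ ->]].
    replace (x * x + x + x + 1) with ((x + 1) * (x + 1)) in H2 by ring.
    apply square_lt_cancel in H1, H2. apply lt_succ_le in H2.
    exact (le_not_lt H2 H1).
Qed.

Lemma bounded_product_iff x y z : bounded_product a b x y z <-> mul_graph_upto L x y z.
Proof.
  unfold bounded_product, mul_graph_upto, in_segment.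
  (* With [n = 2L + 2], even the square of [x + y + 1], needed to detect the root [x + y], is
     coded. *)
  assert (Hsum : forall x y, x <= L -> y <= L -> x + y + 1 < n).
  { intros x' y' Hx Hy. rewrite Hn.
    apply le_lt_succ, add_le; [now apply add_le | apply le_refl]. }
  assert (Hle : forall x, x <= L -> x + 1 < n).
  { intros x' Hx. apply le_lt_trans with (x' + 0 + 1); [rewrite add_0_r; apply le_refl |].
    now apply Hsum; [| apply le_0_l]. }
  split.
  - intros [[l [_ [El [Hx Hy]]]] [u [_ [Hu [v [_ [Hv [w [_ [Hw E]]]]]]]]]].
    apply (scaled_one l S3) in El. subst l.
    apply (bounded_root_iff u (Hle _ Hx)) in Hu.
    apply (bounded_root_iff v (Hle _ Hy)) in Hv.
    apply (bounded_root_iff w (Hsum _ _ Hx Hy)) in Hw. subst u v w.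
    split; [split; [apply le_0_l | exact Hx] |].
    split; [split; [apply le_0_l | exact Hy] |].
    apply double_cancel, (add_cancel_l (z := x * x + y * y)).
    rewrite add_assoc, <- E. ring.
  - intros [[_ Hx] [[_ Hy] ->]].
    assert (Hlt : forall x, x + 1 < n -> x * x < b).
    { intros x' H. apply square_bounded.
      apply le_lt_trans with (x' + 1); [apply le_add_r | exact H]. }
    split.
    { exists L. split; [exact (scalar_bounded S3) |].
      split; [now apply (scaled_one L S3) | now split]. }
    exists (x * x). split; [now apply Hlt, Hle |].
    split; [now apply bounded_root_iff; [apply Hle |] |].
    exists (y * y). split; [now apply Hlt, Hle |].
    split; [now apply bounded_root_iff; [apply Hle |] |].
    exists ((x + y) * (x + y)). split; [now apply Hlt, Hsum |].
    split; [now apply bounded_root_iff; [apply Hsum |] | ring].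
Qed.

End Correctness.

End Arithmetic.

Theorem theorem3p1 (M : structure arith) (HPA : PA_model M)
    (Hns : nonstandard M) (L : M) :
  exists a b : M, lt a b /\
    exists p : formula additive_ab,
      b_bounded p /\ @defines3 additive_ab (additive_expansion a b) p (mul_graph_upto L).
Proof.
  pose (n := add (add (add L L) (one M)) (one M)).
  pose (B := mul n n).
  assert (Hn : lt (zero M) n) by (apply (le_lt_succ HPA), (le_0_l HPA)).
  assert (HB : forall k, lt k n -> lt (mul k k) B).
  { intros k Hk. apply (le_lt_trans HPA (y := mul n k)).
    - apply (mul_le HPA); [now apply lt_le | apply (le_refl HPA)].
    - now apply (mul_lt_l HPA). }
  destruct (squares_coded HPA HB) as [p [q [p1 [q1 [G [Hq [_ [Hcode Hall]]]]]]]].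
  (* Large enough for every argument to be scaled: 1, the records [x < q], and anything up to
     [p * x] or [B * G * x]. *)
  pose (X := mul (add (add p (mul B G)) (one M)) q).
  destruct (@scalars_exist M HPA p q (mul B G) L (mul B q) X)
    as [a [b [Hab [S0 [S1 [S2 [S3 S4]]]]]]].
  - apply (mul_pos HPA); [| exact Hq]. now apply (mul_pos HPA).
  - apply (le_trans HPA (y := mul (one M) q)).
    + rewrite (mul_1_l HPA), <- (add_0_l HPA (one M)). now apply (lt_le_succ HPA).
    + apply (mul_le HPA); [| apply (le_refl HPA)].
      rewrite (add_comm HPA). apply (le_add_r HPA).
  - exists a, b. split; [exact Hab |].
    destruct (bounded_product_definable HPA a b) as [f [Hf [Hfree Hsat]]].
    exists f. split; [exact Hf | split; [exact Hfree |]].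
    intros e x y z. rewrite (Hsat (scons x (scons y (scons z e)))). simpl.
    apply (@bounded_product_iff M HPA L n B p q G X a b); auto.
Qed.
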